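(* Let $\mathcal{R}$ be a commutative ring with unity and let $\mathcal{A}$ be a zero product determined $\mathcal{R}$-algebra. Then for any right $\mathcal{A}$-module $\mathcal{X}$, every local left multiplier $\psi:\mathcal{A}\rightarrow\mathcal{X}$ is a left multiplier.
   Context: All algebras are associative $\mathcal{R}$-algebras with unity $1$ and all modules are unital; modules over an $\mathcal{R}$-algebra are $\mathcal{R}$-modules in the compatible way. For an algebra $\mathcal{A}$ and a right $\mathcal{A}$-module $\mathcal{X}$, an $\mathcal{R}$-linear map $\psi:\mathcal{A}\to\mathcal{X}$ is a left multiplier if $\psi(a)=\psi(1)a$ for all $a\in\mathcal{A}$; it is a local left multiplier if for each $a\in\mathcal{A}$ there exists $x_a\in\mathcal{X}$ with $\psi(a)=x_a a$. The algebra $\mathcal{A}$ is zero product determined if for every $\mathcal{R}$-module $\mathcal{Y}$ and every $\mathcal{R}$-bilinear map $\phi:\mathcal{A}\times\mathcal{A}\to\mathcal{Y}$ satisfying $\phi(a,b)=0$ whenever $ab=0$, there exists an $\mathcal{R}$-linear map $L:\mathcal{A}^2\to\mathcal{Y}$ such that $\phi(a,b)=L(ab)$ for all $a,b\in\mathcal{A}$ (here $\mathcal{A}^2=\mathcal{A}$ since $\mathcal{A}$ is unital). *)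

(* Defs.v *)
From HB Require Import structures.
From mathcomp Require Import all_boot all_algebra.

Set Implicit Arguments.
Unset Strict Implicit.
Unset Printing Implicit Defensive.

Import GRing.Theory.

Local Open Scope ring_scope.

(* The R-action on X is the one compatible with the A-action:
   (r x) a = r (x a) = x (r a). *)
HB.mixin Record Lmodule_isRightModule (R : comNzRingType) (A : algType R) X
    of GRing.Lmodule R X := {
  ract : X -> A -> X;
  ractDl : forall a, {morph ract^~ a : x y / x + y};
  ractDr : forall x, {morph ract x : a b / a + b};
  ract1 : forall x, ract x 1 = x;
  ractM : forall x a b, ract x (a * b) = ract (ract x a) b;
  ractZl : forall r x a, ract (r *: x) a = r *: ract x a;
  ractZr : forall r x a, ract x (r *: a) = r *: ract x a
}.

#[short(type="rightModType")]
HB.structure Definition RightModule (R : comNzRingType) (A : algType R) :=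
  {X of GRing.Lmodule R X & Lmodule_isRightModule R A X}.

Notation "x *> a" := (ract x a) (at level 40, left associativity) : ring_scope.

Definition left_multiplier (R : comNzRingType) (A : algType R)
    (X : rightModType A) (psi : {linear A -> X}) : Prop :=
  forall a : A, psi a = psi 1 *> a.

Definition local_left_multiplier (R : comNzRingType) (A : algType R)
    (X : rightModType A) (psi : {linear A -> X}) : Prop :=
  forall a : A, exists x : X, psi a = x *> a.

(* Since A is unital, the span of the products a * b is all of A, so that L is
   defined on A itself. *)
Definition zero_product_determined (R : comNzRingType) (A : algType R) : Prop :=
  forall (Y : lmodType R) (phi : {bilinear A -> A -> Y}),
    (forall a b : A, a * b = 0 -> phi a b = 0) ->
    exists L : {linear A -> Y}, forall a b : A, phi a b = L (a * b).

(* Main.v *)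
From HB Require Import structures.
Require Import Defs.
From mathcomp Require Import all_boot all_algebra.

(** Fix a local left multiplier psi. The map (a, b) |-> psi a *> b is bilinear
    (multiplier_form_bilinear) and kills the pairs with a * b = 0
    (multiplier_form_eq0), because psi a = x *> a for some x
    (depending on a), whence psi a *> b = x *> (a * b). Zero product
    determination therefore makes it a function of the product a * b alone; the
    pairs (a, 1) and (1, a) have the same product a, and comparing their images
    gives psi a = psi 1 *> a. *)

Set Implicit Arguments.
Unset Strict Implicit.
Unset Printing Implicit Defensive.

Import GRing.Theory.
Local Open Scope ring_scope.

Lemma ract0 (R : comNzRingType) (A : algType R) (X : rightModType A) (x : X) :
  x *> (0 : A) = 0.
Proof. by rewrite -(scale0r (0 : A)) ractZr scale0r. Qed.

Section MultiplierForm.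

Variables (R : comNzRingType) (A : algType R) (X : rightModType A).
Variable psi : {linear A -> X}.

Definition multiplier_form (a b : A) : X := psi a *> b.

Lemma multiplier_form_bilinear :
  bilinear_for *:%R *:%R multiplier_form.
Proof.
rewrite /multiplier_form; split=> [b r a a' | a r b b'] /=.
  by rewrite linearP ractDl ractZl.
by rewrite ractDr ractZr.
Qed.

HB.instance Definition _ :=
  bilinear_isBilinear.Build R A A X *:%R *:%R multiplier_form
    multiplier_form_bilinear.

(** The local witness x for psi at a turns the form into x *> (a * b); it may
    vary with a, but only the fixed pair (a, b) matters here. *)
Lemma multiplier_form_eq0 (a b : A) :
  local_left_multiplier psi -> a * b = 0 -> multiplier_form a b = 0.
Proof.
move=> hpsi ab0; have [x psi_a] := hpsi a.
by rewrite /multiplier_form psi_a -ractM ab0 ract0.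
Qed.

End MultiplierForm.

Theorem theorem3p1 (R : comNzRingType) (A : algType R)
    (hA : zero_product_determined A)
    (X : rightModType A) (psi : {linear A -> X})
    (hpsi : local_left_multiplier psi) :
  left_multiplier psi.
Proof.
have [a b ab0 | L formE a] := hA X (multiplier_form psi : {bilinear A -> A -> X}).
  exact: multiplier_form_eq0.
(* Both (1, a) and (a, 1) have product a. *)
have := formE 1 a; rewrite mul1r -[in L a](mulr1 a) -formE.
by rewrite /= /multiplier_form ract1.
Qed.
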